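(* Let $(X,d)$ be a metric space, $A\subset X$ a nonempty closed set, and let $\mathbf{F}:\Delta\to(0,1]$ be a Tietze extender. For each $\varphi\in\ell_\infty^+(A)$ define $\Omega_{\mathbf{F}}[\varphi]:X\to[0,+\infty)$ by $\Omega_{\mathbf{F}}[\varphi](p)=\varphi(p)$ for $p\in A$ and $$\Omega_{\mathbf{F}}[\varphi](p)=\sup_{a\in A}\varphi(a)\cdot\mathbf{F}\big(d(a,p),d(p,A)\big),\quad\text{for every } p\in X\setminus A.$$ Then the extension operator $\Omega_{\mathbf{F}}:\ell_\infty^+(A)\to\ell_\infty^+(X)$ is a sublinear isotone isometry which preserves both continuity and uniform continuity.
   Context: $d(p,A)=\inf\{d(p,a):a\in A\}$; subsets of $X$ carry the restricted metric. Let $\Delta=\{(s,t)\in\mathbb{R}^2: s\ge t>0\}$. A function $\mathbf{F}:\Delta\to(0,1]$ is called a Tietze extender if: (i) $\lim_{t\to0}\mathbf{F}(t,t)=1$, and $\lim_{t\to0}\mathbf{F}(s,t)=0$ for every fixed $s>0$; (ii) for every fixed $t>0$, $\mathbf{F}(\cdot,t)$ is decreasing (not necessarily strictly); (iii) for every $\tau>0$, $\mathbf{F}(s,t)$ is uniformly continuous on $\{(s,t): s\ge t\ge\tau\}$. For a nonempty set $Z$, $\ell_\infty(Z)$ is the space of all bounded real-valued functions on $Z$ with the sup-norm $\|\varphi\|=\sup|\varphi|$ and the pointwise order, and $\ell_\infty^+(Z)$ is the set of its members with values in $[0,+\infty)$. An operator $\Omega:\ell_\infty^+(A)\to\ell_\infty^+(X)$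 is: an extension operator if $\Omega[\varphi]\upharpoonright A=\varphi$ for all $\varphi$; sublinear if $\Omega[\varphi+\psi]\le\Omega[\varphi]+\Omega[\psi]$ and $\Omega[\lambda\varphi]=\lambda\Omega[\varphi]$ for all $\varphi,\psi\in\ell_\infty^+(A)$ and $\lambda\ge0$; isotone if $\varphi\le\psi$ implies $\Omega[\varphi]\le\Omega[\psi]$; an isometry if $\|\Omega[\varphi]-\Omega[\psi]\|=\|\varphi-\psi\|$ for all $\varphi,\psi$. It preserves continuity (respectively, uniform continuity) if $\Omega[\varphi]$ is continuous (respectively, uniformly continuous) on $X$ whenever $\varphi\in\ell_\infty^+(A)$ is continuous (respectively, uniformly continuous) on $A$. *)

(* Defs.v *)
From HB Require Import structures.
From mathcomp Require Import all_boot all_order all_algebra.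
From mathcomp Require Import all_classical all_reals all_analysis.

Set Implicit Arguments.
Unset Strict Implicit.
Unset Printing Implicit Defensive.

Import Order.TTheory GRing.Theory Num.Theory.
Import numFieldNormedType.Exports.

Local Open Scope classical_set_scope.
Local Open Scope ring_scope.

Definition dist_to_set (R : realType) (X : metricType R) (p : X) (A : set X) : R :=
  inf [set mdist p a | a in A].

Definition Delta (R : realType) : set (R * R) := [set x | 0 < x.2 <= x.1].

(* A function on Delta is represented by a total function on R * R (in curried
   form); every condition below only involves its values on Delta. *)
Record Tietze_extender (R : realType) (F : R -> R -> R) : Prop := {
  te_range : forall s t, Delta (s, t) -> 0 < F s t <= 1 ;
  te_diag : F t t @[t --> 0^'+] --> (1 : R) ;
  te_vanish : forall s : R, 0 < s -> F s t @[t --> 0^'+] --> (0 : R) ;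
  te_decr : forall t s1 s2, Delta (s1, t) -> Delta (s2, t) ->
    s1 <= s2 -> F s2 t <= F s1 t ;
  te_unif : forall tau : R, 0 < tau ->
    unif_continuous (fun x : [set x : R * R | tau <= x.2 <= x.1] =>
                       F (set_val x).1 (set_val x).2) }.

Definition ell_inf (R : realType) (Z : Type) : set (Z -> R) := bounded_fun.

Definition ell_inf_pos (R : realType) (Z : Type) : set (Z -> R) :=
  ell_inf (Z := Z) `&` [set phi | forall z, 0 <= phi z].

Definition ell_inf_norm (R : realType) (Z : Type) (phi : Z -> R) : R :=
  sup (range (fun z => `|phi z|)).

Section Operators.
Context {R : realType} {X : metricType R} (A : set X).
Implicit Type Omega : (A -> R) -> (X -> R).

(* An operator from ell_inf_pos A to ell_inf_pos X is represented by a map on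
   all real functions; the properties below only concern its restriction to
   ell_inf_pos A. *)
Definition ell_inf_pos_operator Omega :=
  set_fun (@ell_inf_pos R A) (@ell_inf_pos R X) Omega.

Definition extension_operator Omega :=
  forall phi, ell_inf_pos phi -> sigL A (Omega phi) = phi.

Definition sublinear_operator Omega :=
  (forall phi psi, ell_inf_pos phi -> ell_inf_pos psi ->
     forall p, Omega (phi \+ psi) p <= Omega phi p + Omega psi p) /\
  (forall (lambda : R) phi, 0 <= lambda -> ell_inf_pos phi ->
     Omega (fun a => lambda * phi a) = (fun p => lambda * Omega phi p)).

Definition isotone_operator Omega :=
  forall phi psi, ell_inf_pos phi -> ell_inf_pos psi ->
    (forall a, phi a <= psi a) -> forall p, Omega phi p <= Omega psi p.

Definition isometry_operator Omega :=
  forall phi psi, ell_inf_pos phi -> ell_inf_pos psi ->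
    ell_inf_norm (Omega phi \- Omega psi) = ell_inf_norm (phi \- psi).

Definition preserves_continuity Omega :=
  forall phi, ell_inf_pos phi -> continuous phi -> continuous (Omega phi).

Definition preserves_unif_continuity Omega :=
  forall phi, ell_inf_pos phi ->
    unif_continuous phi -> unif_continuous (Omega phi).

(* [insub p] is [Some a], with [a] the point [p] viewed in [A], iff [p \in A]. *)
Definition Omega_ext (F : R -> R -> R) (phi : A -> R) (p : X) : R :=
  if insub p is Some a then phi a
  else sup (range (fun a : A =>
         phi a * F (mdist (set_val a) p) (dist_to_set p A))).

End Operators.

(* Main.v *)
Require Import Defs.
From mathcomp Require Import all_boot all_order all_algebra.
From mathcomp Require Import all_classical all_reals all_analysis.
From mathcomp Require Import lra.

(** Everything rests on writing the extension, on [A] as well as off [A], as a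
    weighted supremum
      Omega[phi](p) = sup_a phi(a) * w(p, a)   with 0 <= w(p, a) <= 1,
    where w(p, a) = F(d(a,p), d(p,A)) off [A] and w(p, _) is the indicator of
    [p] when [p] lies in [A] ([Omega_weightE]).  Sublinearity and isotonicity
    are then properties of suprema.  Since the supremum map is 1-Lipschitz and
    the weights are at most 1, Omega does not increase distances; since it
    extends, it does not decrease them either.

    Continuity combines two estimates.  Off [A], the maps p |-> d(a,p) are
    1-Lipschitz uniformly in [a], and so is p |-> d(p,A); as F is uniformly
    continuous where t >= tau, the weights move uniformly little in [a], and
    Omega[phi] is uniformly continuous on {p : d(p,A) >= tau} for any bounded
    [phi] ([Omega_unif_away]).

    Near a point a0 of [A], Omega[phi](p) is close to phi(a0)
    ([Omega_near_A]).  It is not much larger, because the points [a] close to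
    a0 have phi(a) close to phi(a0), while the points at distance at least d
    from a0 have weight at most F(d/2, t) with t = d(p,A), which tends to 0 with
    t.  It is not much smaller, because a nearly nearest point [a] of [A] to p
    is close to a0 and has weight close to F(t,t), which tends to 1.  The radius
    within which this holds depends on a0 only through the scale d at which phi
    oscillates little, so the same estimate serves for continuity and for
    uniform continuity.  Uniform continuity on [X] follows by splitting
    according to whether d(p,A) is small. *)

Set Implicit Arguments.
Unset Strict Implicit.
Unset Printing Implicit Defensive.

Import Order.TTheory GRing.Theory Num.Theory.
Import numFieldNormedType.Exports.

Local Open Scope classical_set_scope.
Local Open Scope ring_scope.

(** * Suprema of bounded functions *)

Section BoundedFunctions.
Context {R : realType} {Z : Type}.
Implicit Types (f g : Z -> R) (c : R).

Lemma sup_range_ge f c z : (forall x, f x <= c) -> f z <= sup (range f).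
Proof.
move=> fc; apply: sup_upper_bound; last by exists z.
by split; [exists (f z), z | exists c => _ [x _ <-]].
Qed.

Lemma sup_range_le f c (z : Z) : (forall x, f x <= c) -> sup (range f) <= c.
Proof. by move=> fc; apply: ge_sup; [exists (f z), z | move=> _ [x _ <-]]. Qed.

Lemma sup_range_le_add f g b c (z : Z) : (forall x, g x <= b) ->
  (forall x, f x <= g x + c) -> sup (range f) <= sup (range g) + c.
Proof.
move=> gb fgc; apply: (sup_range_le z) => x.
by rewrite (le_trans (fgc x))// lerD2r (sup_range_ge x gb).
Qed.

(** The supremum is 1-Lipschitz for the sup-norm: this one fact gives both the
    isometry and the uniform continuity away from [A]. *)
Lemma sup_range_dist_le f g b c (z : Z) : (forall x, f x <= b) ->
  (forall x, g x <= b) -> (forall x, `|f x - g x| <= c) ->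
  `|sup (range f) - sup (range g)| <= c.
Proof.
move=> fb gb fgc; rewrite ler_distlC lerBlDr.
rewrite (sup_range_le_add z fb) ?(sup_range_le_add z gb)// => x;
  by have := fgc x; rewrite ler_distlC => /andP[]; lra.
Qed.

(** For [l > 0] the nontrivial inequality is the trivial one read through
    division by [l]; [l = 0] has to be treated apart. *)
Lemma sup_rangeZ (l : R) f b (z : Z) : 0 <= l -> (forall x, f x <= b) ->
  sup (range (fun x => l * f x)) = l * sup (range f).
Proof.
move=> l0 fb; have lfb x : l * f x <= l * b by rewrite ler_wpM2l.
apply/le_anti/andP; split.
  by apply: (sup_range_le z) => x; rewrite ler_wpM2l// (sup_range_ge x fb).
have := l0; rewrite [0 <= l]le_eqVlt => /predU1P[l_eq0|l_gt0].
  by have := sup_range_ge z lfb; rewrite -l_eq0 !mul0r.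
rewrite mulrC -ler_pdivlMr//; apply: (sup_range_le z) => x.
by rewrite ler_pdivlMr// mulrC (sup_range_ge x lfb).
Qed.

Lemma ell_inf_posP f :
  ell_inf_pos f <-> exists2 M, 0 < M & forall z, 0 <= f z <= M.
Proof.
split=> [[fbnd f0]|[M M0 fM]].
  have [M M0 fM] := ex_strict_bound_gt0 fbnd.
  exists M => // z; apply/andP; split; first exact: f0.
  by apply: (le_trans (ler_norm _)); apply/ltW; exact: fM.
split; last by move=> z; have /andP[] := fM z.
exists M; split=> [|x Mx z _ /=]; first exact: num_real.
have /andP[f0 fzM] := fM z; rewrite ger0_norm//.
exact: le_trans fzM (ltW Mx).
Qed.

Lemma ell_inf_norm_le f c (z : Z) : (forall x, `|f x| <= c) ->
  ell_inf_norm f <= c.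
Proof. exact: sup_range_le. Qed.

Lemma le_ell_inf_norm f g z : ell_inf_pos f -> ell_inf_pos g ->
  `|f z - g z| <= ell_inf_norm (f \- g).
Proof.
move=> /ell_inf_posP[M _ fM] /ell_inf_posP[N _ gN].
apply: (@sup_range_ge (fun x => `|(f \- g) x|) (M + N)) => x /=.
by have := fM x; have := gN x; rewrite ler_norml; lra.
Qed.

End BoundedFunctions.

(** * Distance to a set *)

Section DistToSet.
Context {R : realType} {X : metricType R} (A : set X).
Implicit Types p q a : X.

Lemma mdist_image_lbound p : lbound [set mdist p a | a in A] 0.
Proof. by move=> _ [a _ <-]; exact: mdist_ge0. Qed.

Lemma dist_to_set_le p a : A a -> dist_to_set p A <= mdist p a.
Proof.
move=> Aa; apply: ge_inf; last by exists a.
by exists 0; exact: mdist_image_lbound.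
Qed.

Lemma dist_to_set_lt p r : A !=set0 -> dist_to_set p A < r ->
  exists2 a, A a & mdist p a < r.
Proof.
move=> [a0 Aa0] /inf_lt[|_ [a Aa <-] ar]; last by exists a.
by exists (mdist p a0), a0.
Qed.

Lemma dist_to_set_le_add p q : A !=set0 ->
  dist_to_set p A <= mdist p q + dist_to_set q A.
Proof.
move=> A0; rewrite -lerBlDl; apply: lb_le_inf => [|_ [a Aa <-]].
  by case: A0 => a Aa; exists (mdist q a), a.
by rewrite lerBlDl (le_trans (dist_to_set_le p Aa))// metric_triangle.
Qed.

Lemma dist_to_set_lip p q : A !=set0 ->
  `|dist_to_set p A - dist_to_set q A| <= mdist p q.
Proof.
move=> A0; have := dist_to_set_le_add p q A0.
have := dist_to_set_le_add q p A0; rewrite (metric_sym q p) ler_norml; lra.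
Qed.

Lemma dist_to_set_gt0 p : closed A -> A !=set0 -> ~ A p ->
  0 < dist_to_set p A.
Proof.
move=> cA A0 nAp; rewrite ltNge; apply/negP => d0; apply: nAp; apply: cA => B.
move=> /nbhs_ballP[e e0 peB].
have [a Aa pae] := dist_to_set_lt A0 (le_lt_trans d0 e0).
by exists a; split => //; apply: peB; rewrite ballEmdist.
Qed.

End DistToSet.

Lemma mdist_lip {R : realType} {X : metricType R} (a p q : X) :
  `|mdist a p - mdist a q| <= mdist p q.
Proof.
have := metric_triangle a q p; have := metric_triangle a p q.
rewrite (metric_sym q p) ler_norml; lra.
Qed.

(** * Tietze extenders in epsilon-delta form *)

(** The subspace uniformity is the initial one along the inclusion, so its balls
    are traces of the balls of the ambient space. *)
Lemma unif_continuous_on_setP {R : realType} {U V : pseudoMetricType R}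
    (A : set U) (f : A -> V) :
  unif_continuous f <-> forall e, 0 < e -> exists2 d, 0 < d &
    forall x y : A, ball (set_val x) d (set_val y) -> ball (f x) e (f y).
Proof.
rewrite unif_continuousP; split=> fe e e0; have [d d0 fd] := fe e e0;
  exists d => //.
  by move=> x y xy; apply: (fd (x, y)).
by move=> [x y]; apply: fd.
Qed.

Section TietzeExtender.
Context {R : realType} (F : R -> R -> R) (F_ext : Tietze_extender F).

Lemma Tietze_extender_unif tau e : 0 < tau -> 0 < e -> exists2 d, 0 < d &
  forall s t s' t', tau <= t <= s -> tau <= t' <= s' ->
    `|s - s'| < d -> `|t - t'| < d -> `|F s t - F s' t'| < e.
Proof.
move=> tau0 e0.
have /unif_continuous_on_setP/(_ e e0)[d d0 Fd] := te_unif F_ext tau0.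
exists d => // s t s' t' st st' ss' tt'.
exact: (Fd (exist _ (s, t) (mem_set st)) (exist _ (s', t') (mem_set st'))).
Qed.

Lemma Tietze_extender_diag e : 0 < e ->
  exists2 d, 0 < d & forall t, 0 < t < d -> 1 - e < F t t.
Proof.
move=> e0; have /cvgrPdist_lt/(_ e e0)[d /= d0 Fd] := te_diag F_ext.
exists d => // t /andP[t0 td]; have := Fd t; rewrite /= sub0r normrN gtr0_norm//.
by move=> /(_ td t0); rewrite ltr_norml; lra.
Qed.

Lemma Tietze_extender_vanish s e : 0 < s -> 0 < e ->
  exists2 d, 0 < d & forall t, 0 < t < d -> F s t < e.
Proof.
move=> s0 e0; have /cvgrPdist_lt/(_ e e0)[d /= d0 Fd] := te_vanish F_ext s0.
exists d => // t /andP[t0 td]; have := Fd t; rewrite /= sub0r normrN gtr0_norm//.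
by move=> /(_ td t0); rewrite ltr_norml; lra.
Qed.

End TietzeExtender.

(** * The extension as a weighted supremum *)

Section Extension.
Context {R : realType} {X : metricType R} (A : set X) (F : R -> R -> R).
Hypotheses (A_closed : closed A) (A_neq0 : A !=set0).
Hypothesis F_ext : Tietze_extender F.
Implicit Types (phi psi : A -> R) (p q : X) (a : A).

Local Notation Omega := (Omega_ext (A := A) F).

(** The indicator on [A] is what makes the supremum formula hold everywhere, so
    that order and norm properties need no case analysis on [p]. *)
Definition weight p a : R :=
  if p \in A then (set_val a == p)%:R
  else F (mdist (set_val a) p) (dist_to_set p A).

Let pt : A. Proof. by case: (cid A_neq0) => x Ax; exists x; exact: mem_set. Qed.

Lemma setvalP a : A (set_val a). Proof. exact/set_mem/(valP a). Qed.

Lemma Delta_dist p a : p \notin A ->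
  0 < dist_to_set p A <= mdist (set_val a) p.
Proof.
move=> /negP pA; rewrite metric_sym dist_to_set_le ?andbT; last exact: setvalP.
by apply: dist_to_set_gt0 => // Ap; apply: pA; exact: mem_set.
Qed.

Lemma weight_ge0_le1 p a : 0 <= weight p a <= 1.
Proof.
rewrite /weight; case: ifPn => [_|pA]; first by case: eqP; rewrite ?lexx ler01.
by have /andP[/ltW-> ->] := te_range F_ext (Delta_dist a pA).
Qed.

Lemma Omega_on phi a : Omega phi (set_val a) = phi a.
Proof. by rewrite /Omega_ext valK. Qed.

Lemma weighted_le phi M p a : (forall b, 0 <= phi b <= M) ->
  0 <= phi a * weight p a <= M.
Proof.
move=> /(_ a)/andP[phi0 phiM]; have /andP[w0 w1] := weight_ge0_le1 p a.
by rewrite mulr_ge0//= (le_trans _ phiM)// ler_piMr.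
Qed.

(** At a point [p] of [A] the supremum is attained at [a = p], all other terms
    being 0; nonnegativity of [phi] is what makes 0 harmless. *)
Lemma Omega_weightE phi p : ell_inf_pos phi ->
  Omega phi p = sup (range (fun a => phi a * weight p a)).
Proof.
move=> /ell_inf_posP[M _ phiM]; have [pA|pA] := boolP (p \in A); last first.
  by rewrite /Omega_ext /weight insubN// (negbTE pA).
have le_w a : phi a * weight p a <= M by have /andP[] := weighted_le p a phiM.
rewrite -[p]/(set_val (exist _ p pA : A)) Omega_on.
apply/le_anti/andP; split.
  by have := sup_range_ge (exist _ p pA : A) le_w; rewrite {1}/weight pA eqxx mulr1.
apply: (sup_range_le pt) => a; rewrite /weight pA; case: eqP => [ap|_].
  by rewrite mulr1 (_ : a = exist _ p pA)//; exact: val_inj.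
by rewrite mulr0; have /andP[] := phiM (exist _ p pA).
Qed.

Lemma Omega_ge phi p a : ell_inf_pos phi -> phi a * weight p a <= Omega phi p.
Proof.
move=> phiP; rewrite Omega_weightE//; have [M _ phiM] := (ell_inf_posP _).1 phiP.
apply: (sup_range_ge (f := fun b => phi b * weight p b) (c := M)) => b.
by have /andP[] := weighted_le p b phiM.
Qed.

Lemma Omega_le phi p c : ell_inf_pos phi ->
  (forall a, phi a * weight p a <= c) -> Omega phi p <= c.
Proof. by move=> phiP le_c; rewrite Omega_weightE//; exact: (sup_range_le pt). Qed.

Lemma Omega_dist_le phi psi p q c : ell_inf_pos phi -> ell_inf_pos psi ->
  (forall a, `|phi a * weight p a - psi a * weight q a| <= c) ->
  `|Omega phi p - Omega psi q| <= c.
Proof.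
move=> phiP psiP le_c; rewrite !Omega_weightE//.
have [[M M0 phiM] [N N0 psiN]] := ((ell_inf_posP _).1 phiP, (ell_inf_posP _).1 psiP).
apply: (@sup_range_dist_le _ _ _ _ (M + N) _ pt) => // a.
  by have := weighted_le p a phiM; lra.
by have := weighted_le q a psiN; lra.
Qed.

(** * Order and norm properties *)

Lemma Omega_ell_inf_pos : ell_inf_pos_operator Omega.
Proof.
move=> phi phiP; have [M M0 phiM] := (ell_inf_posP _).1 phiP.
apply/ell_inf_posP; exists M => // p; apply/andP; split.
  apply: le_trans (Omega_ge p pt phiP).
  by have /andP[] := weighted_le p pt phiM.
by apply: Omega_le => // a; have /andP[] := weighted_le p a phiM.
Qed.

Lemma Omega_sublinear : sublinear_operator Omega.
Proof.
split=> [phi psi phiP psiP p|l phi l0 phiP].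
  have [[M M0 phiM] [N N0 psiN]] :=
    ((ell_inf_posP _).1 phiP, (ell_inf_posP _).1 psiP).
  apply: Omega_le => [|a]; last by rewrite mulrDl lerD// Omega_ge.
  apply/ell_inf_posP; exists (M + N); first exact: addr_gt0.
  by move=> a /=; have := phiM a; have := psiN a; lra.
have [M M0 phiM] := (ell_inf_posP _).1 phiP.
apply/funext => p; rewrite !Omega_weightE//; last first.
  (* The + 1 keeps the bound positive when [l = 0]. *)
  apply/ell_inf_posP; exists (l * M + 1); first by rewrite ltr_wpDl// mulr_ge0// ltW.
  move=> a; have /andP[phi0 ?] := phiM a; rewrite mulr_ge0//= ler_wpDr//.
  exact: ler_wpM2l.
rewrite -(@sup_rangeZ _ _ _ _ M pt)//; last first.
  by move=> a; have /andP[] := weighted_le p a phiM.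
by under eq_fun do rewrite -mulrA.
Qed.

Lemma Omega_isotone : isotone_operator Omega.
Proof.
move=> phi psi phiP psiP le_phi p; apply: Omega_le => // a.
apply: le_trans (Omega_ge p a psiP); apply: ler_wpM2r => //.
by have /andP[] := weight_ge0_le1 p a.
Qed.

(** Weights at most 1 make the operator nonexpansive; restricting the difference
    of two extensions to [A] gives the opposite inequality. *)
Lemma Omega_isometry : isometry_operator Omega.
Proof.
move=> phi psi phiP psiP; apply/le_anti/andP; split.
  apply: (ell_inf_norm_le (set_val pt)) => p /=.
  apply: Omega_dist_le => // a; rewrite -mulrBl normrM.
  apply: le_trans (le_ell_inf_norm a phiP psiP).
  have /andP[w0 w1] := weight_ge0_le1 p a.
  by rewrite (ger0_norm w0) ler_piMr.
apply: (ell_inf_norm_le pt) => a /=; rewrite -!Omega_on.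
by apply: le_ell_inf_norm; exact: Omega_ell_inf_pos.
Qed.

(** * Continuity *)

(** Where [d(p,A) >= tau], both arguments of F move by at most [d(p,q)],
    uniformly in [a], within the region on which F is uniformly continuous.
    With [phi] bounded by [M], a variation [e / M] of the weights suffices. *)
Lemma Omega_unif_away phi tau e : ell_inf_pos phi -> 0 < tau -> 0 < e ->
  exists2 d, 0 < d & forall p q,
    tau <= dist_to_set p A -> tau <= dist_to_set q A -> mdist p q < d ->
    `|Omega phi p - Omega phi q| <= e.
Proof.
move=> phiP tau0 e0; have [M M0 phiM] := (ell_inf_posP _).1 phiP.
have [d d0 Fd] := Tietze_extender_unif F_ext tau0 (divr_gt0 e0 M0).
have out p : tau <= dist_to_set p A -> p \notin A.
  apply: contraTN => /set_mem Ap; rewrite -ltNge (le_lt_trans _ tau0)//.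
  by rewrite -(mdistxx p) dist_to_set_le.
exists d => // p q taup tauq pqd; apply: Omega_dist_le => // a.
have /andP[phi0 phia] := phiM a; rewrite -mulrBr normrM (ger0_norm phi0).
rewrite /weight (negbTE (out _ taup)) (negbTE (out _ tauq)).
rewrite -(divfK (lt0r_neq0 M0) e) mulrC ler_pM// ltW//.
apply: Fd.
- by rewrite taup metric_sym dist_to_set_le//; exact: setvalP.
- by rewrite tauq metric_sym dist_to_set_le//; exact: setvalP.
- exact: le_lt_trans (mdist_lip _ _ _) pqd.
- exact: le_lt_trans (dist_to_set_lip _ _ A_neq0) pqd.
Qed.

(** The radius [r] is chosen before [a0]: it depends on [phi], [d] and [e] only.
    One [e] pays for the oscillation of [phi] at scale [d], the other for the
    defect of the weights: those of points near [p] may fall short of 1, and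
    those of points far from [a0] may exceed 0. *)
Lemma Omega_near_A phi d e : ell_inf_pos phi -> 0 < d -> 0 < e ->
  exists2 r, 0 < r & forall a0,
    (forall a, mdist (set_val a0) (set_val a) < d -> `|phi a0 - phi a| <= e) ->
    forall p, mdist (set_val a0) p < r -> `|phi a0 - Omega phi p| <= e *+ 2.
Proof.
move=> phiP d0 e0; have [M M0 phiM] := (ell_inf_posP _).1 phiP.
(* Half of the weight defect [e / M] is for F(t,t) versus 1, half for
   F(d(a,p),t) versus F(t,t). *)
have eta0 : 0 < e / M / 2 by rewrite !divr_gt0.
have [r1 r10 Fdiag] := Tietze_extender_diag F_ext eta0.
have d20 : 0 < d / 2 by rewrite divr_gt0.
have [r2 r20 Fvan] := Tietze_extender_vanish F_ext d20 (divr_gt0 e0 M0).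
(* With [d(a0,p) < d / 4] the nearly nearest point below is within
   [t + t + d / 4 < d] of [a0], and points at distance at least [d] from [a0]
   are at distance at least [d / 2] from [p]. *)
exists (Num.min (d / 4) (Num.min r1 r2)); first by rewrite !lt_min r10 r20 divr_gt0.
move=> a0 phi_a0 p; rewrite !lt_min => /and3P[pd pr1 pr2].
have [pA|pA] := boolP (p \in A).
  rewrite -[p]/(set_val (exist _ p pA : A)) Omega_on.
  by rewrite (le_trans (phi_a0 _ _)) ?mulr2n ?lerDl ?ltW// (lt_trans pd)//; lra.
set t := dist_to_set p A.
have /andP[t0 t_a0] : 0 < t <= mdist (set_val a0) p := Delta_dist a0 pA.
have /andP[phi_a00 phi_a0M] := phiM a0.
have phiw a : phi a * weight p a = phi a * F (mdist (set_val a) p) t.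
  by rewrite /weight (negbTE pA).
rewrite ler_distlC; apply/andP; split.
  (* Lower bound on the extension, from one nearly nearest point [a].  The
     scale [h] depends on [t], but the radius is already fixed. *)
  have [h h0 Fh] := Tietze_extender_unif F_ext t0 eta0.
  have [|b Ab] := @dist_to_set_lt _ _ A p (t + Num.min h t) A_neq0.
    by rewrite ltrDl lt_min h0.
  rewrite metric_sym.
  pose a : A := exist _ b (mem_set Ab); rewrite -[b]/(set_val a) => a_lt.
  have [ah a2t] : mdist (set_val a) p < t + h /\ mdist (set_val a) p < t + t.
    by split; apply: lt_le_trans a_lt _; rewrite lerD2l ge_min lexx ?orbT.
  have /andP[_ ta] : 0 < t <= mdist (set_val a) p := Delta_dist a pA.
  have Fa : 1 - e / M < F (mdist (set_val a) p) t.
    have := Fdiag t; rewrite t0 (le_lt_trans t_a0 pr1) => /(_ isT).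
    have := Fh (mdist (set_val a) p) t t t; rewrite !lexx ta subrr normr0 h0.
    rewrite ger0_norm ?subr_ge0// => /(_ isT isT); rewrite ltrBlDl => /(_ ah isT).
    by rewrite ltr_norml; lra.
  have phi_a : `|phi a0 - phi a| <= e.
    apply: phi_a0; apply: le_lt_trans (metric_triangle _ p _) _.
    by rewrite (metric_sym p); lra.
  have /andP[phia_0 phia_M] := phiM a.
  (* [e = e / M * M] matches the bounds on the two factors. *)
  have : phi a * (1 - F (mdist (set_val a) p) t) <= e.
    rewrite -(divfK (lt0r_neq0 M0) e) mulrC.
    have /andP[_ F1] := te_range F_ext (Delta_dist a pA).
    by rewrite ler_pM ?subr_ge0//; lra.
  have := Omega_ge p a phiP; rewrite phiw; move: phi_a; rewrite ler_norml; lra.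
(* Upper bound, where all points of [A] compete: those within [d] of [a0] by the
   oscillation of [phi], the others by the decay of F(d/2, _). *)
apply: Omega_le => // a; rewrite phiw.
have /andP[phia_0 phia_M] := phiM a.
have Da := Delta_dist a pA; have /andP[F0 F1] := te_range F_ext Da.
have [ad|da] := ltP (mdist (set_val a0) (set_val a)) d.
  have := phi_a0 _ ad; rewrite ler_norml => phi_a.
  by apply: (@le_trans _ _ (phi a)); [rewrite ler_piMr | lra].
have ap : d / 2 <= mdist (set_val a) p.
  have := metric_triangle (set_val a0) p (set_val a); rewrite (metric_sym p); lra.
have Fad : F (mdist (set_val a) p) t <= e / M.
  apply: le_trans (ltW (Fvan t _)); last by rewrite t0 (le_lt_trans t_a0 pr2).
  by apply: (te_decr F_ext) => //; rewrite /Delta/= t0/=; lra.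
have : phi a * F (mdist (set_val a) p) t <= e.
  by rewrite -(divfK (lt0r_neq0 M0) e) mulrC ler_pM// ltW.
lra.
Qed.

Lemma Omega_continuous : preserves_continuity Omega.
Proof.
move=> phi phiP phi_cont p; apply/cvgrPdist_le => e e0.
have [pA|pA] := boolP (p \in A).
  pose a0 : A := exist _ p pA; have e20 : 0 < e / 2 by rewrite divr_gt0.
  have /cvgrPdist_le/(_ _ e20)/nbhs_ballP[d /= d0 phid] := phi_cont a0.
  have [r r0 Or] := Omega_near_A phiP d0 e20.
  apply/nbhs_ballP; exists r => //= q; rewrite ballEmdist/= => pq.
  rewrite -[p]/(set_val a0) Omega_on (splitr e) -mulr2n; apply: Or => // a a0a.
  apply: phid; suff : ball (set_val a0) d (set_val a) by [].
  by rewrite ballEmdist.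
have /andP[t0 _] := Delta_dist pt pA; have tau0 := divr_gt0 t0 (@ltr0n R 2).
have [d d0 Od] := Omega_unif_away phiP tau0 e0.
apply/nbhs_ballP; exists (Num.min d (dist_to_set p A / 2)) => /=.
  by rewrite lt_min d0.
move=> q; rewrite ballEmdist/= lt_min => /andP[pqd pqt]; apply: Od => //.
  by lra.
by have := dist_to_set_lip p q A_neq0; rewrite ler_norml; lra.
Qed.

(** If [d(p,A) < r / 2], both points are within [r] of one point of [A], where
    [Omega_near_A] holds with a uniform radius [r].  Otherwise both points stay at
    distance at least [r / 4] from [A].  The constant [e / 8] comes from using
    the doubled estimate of [Omega_near_A] twice. *)
Lemma Omega_unif_continuous : preserves_unif_continuity Omega.
Proof.
move=> phi phiP /unif_continuous_on_setP phi_uc; apply/unif_continuousP => e e0.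
have e80 : 0 < e / 8 by rewrite divr_gt0.
have [d d0 phid] := phi_uc _ e80.
have [r r0 Or] := Omega_near_A phiP d0 e80.
have near_phi a0 p : mdist (set_val a0) p < r ->
    `|phi a0 - Omega phi p| <= e / 8 *+ 2.
  apply: Or => a a0a; apply/ltW; apply: (phid a0 a).
  by rewrite ballEmdist.
have r40 : 0 < r / 4 by rewrite divr_gt0.
have e20 : 0 < e / 2 by rewrite divr_gt0.
have [h h0 Oh] := Omega_unif_away phiP r40 e20.
exists (Num.min h (r / 4)); first by rewrite lt_min h0.
move=> [p q]; rewrite ballEmdist/= lt_min => /andP[pqh pqr].
rewrite /ball/=.
have [pr|rp] := ltP (dist_to_set p A) (r / 2).
  have [b Ab pb] := dist_to_set_lt A_neq0 pr.
  pose a : A := exist _ b (mem_set Ab).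
  have ap : mdist (set_val a) p < r / 2 by rewrite metric_sym.
  have aq : mdist (set_val a) q < r.
    by apply: le_lt_trans (metric_triangle _ p _) _; lra.
  have apr : mdist (set_val a) p < r by lra.
  have := near_phi a p apr; have := near_phi a q aq.
  by rewrite !ler_norml ltr_norml mulr2n; lra.
apply: le_lt_trans (Oh p q _ _ pqh) _; [lra| |lra].
by have := dist_to_set_lip p q A_neq0; rewrite ler_norml; lra.
Qed.

End Extension.

Theorem theorem3p1 (R : realType) (X : metricType R) (A : set X)
    (F : R -> R -> R) (A_closed : closed A) (A_neq0 : A !=set0)
    (F_ext : Tietze_extender F) :
  [/\ ell_inf_pos_operator (Omega_ext (A := A) F)
        /\ extension_operator (Omega_ext (A := A) F),
      sublinear_operator (Omega_ext (A := A) F),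
      isotone_operator (Omega_ext (A := A) F),
      isometry_operator (Omega_ext (A := A) F)
    & preserves_continuity (Omega_ext (A := A) F)
      /\ preserves_unif_continuity (Omega_ext (A := A) F)].
Proof.
split; [split| | | |split].
- exact: Omega_ell_inf_pos.
- by move=> phi _; apply/funext => a; rewrite /sigL/= Omega_on.
- exact: Omega_sublinear.
- exact: Omega_isotone.
- exact: Omega_isometry.
- exact: Omega_continuous.
- exact: Omega_unif_continuous.
Qed.
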